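(* Let $\psi$ be the unique irreducible character of degree $7$ of $GL_4(\mathbb{F}_2) \cong A_8$ (the character of the permutation representation of $A_8$ on $8$ points, minus the trivial character), and let $$\mathcal{X}(GL_4(\mathbb{F}_2)) = \{\chi^{(1^4)},\ \chi^{(2,1^2)},\ \chi^{(2^2)},\ \chi^{(3,1)},\ \psi\},$$ where $\chi^\mu$ are the unipotent characters of $GL_4(\mathbb{F}_2)$. Then $\mathcal{X}(GL_4(\mathbb{F}_2))$ marks every proper subgroup of $GL_4(\mathbb{F}_2)$; that is, for every proper subgroup $K$ there is $\chi \in \mathcal{X}(GL_4(\mathbb{F}_2))$ such that $\chi|_K$ contains the trivial character $\mathbb{1}_K$ as a summand.
   Context: All characters are complex characters. A set $\mathcal{X}$ of characters of a finite group $G$ marks a subgroup $K \le G$ if there is $\chi \in \mathcal{X}$ with $\langle \chi|_K, \mathbb{1}_K\rangle_K > 0$. Unipotent characters: for a partition $\lambda = (\lambda_1,\dots,\lambda_\ell)$ of $n$ let $P_\lambda \le GL_n(\mathbb{F}_q)$ be the subgroup of invertible block upper triangular matrices with diagonal blocks of sizes $\lambda_1,\dots,\lambda_\ell$, and let $\mathbb{1}_\lambda = \mathrm{Ind}_{P_\lambda}^{GL_n(\mathbb{F}_q)}(\mathbb{1}_{P_\lambda})$. The unipotent characters $\chi^\mu$ ($\mu \vdash n$) are the irreducible characters of $GL_n(\mathbb{F}_q)$ uniquely determined by $\mathbb{1}_\lambda = \sum_{\mu \vdash n} K_{\mu\lambda}\chi^\mu$ for all $\lambda \vdash n$, where $K_{\mu\lambda}$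 are the Kostka numbers. Here $n=4$, $q=2$. $1^k$, $2^k$ in a partition denote $k$ repeated parts. *)

(* Defs.v *)
From mathcomp Require Import all_boot all_order all_algebra all_fingroup.
From mathcomp Require Import all_solvable all_field all_character.

Set Implicit Arguments.
Unset Strict Implicit.
Unset Printing Implicit Defensive.

Import Order.TTheory GroupScope GRing.Theory Num.Theory.

Local Open Scope ring_scope.

Definition is_partition (n : nat) (la : seq nat) : bool :=
  [&& sorted geq la, 0%N \notin la & sumn la == n].

(* Enumeration of the partitions of n with all parts at most m, according to
   the multiplicity k of the part m. *)
Fixpoint partitions_le (m n : nat) : seq (seq nat) :=
  if m is m'.+1 then
    flatten [seq [seq nseq k m ++ s | s <- partitions_le m' (n - k * m)]
            | k <- iota 0 (n %/ m).+1]
  else if n == 0%N then [:: [::]] else [::].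

Definition partitions (n : nat) : seq (seq nat) := partitions_le n n.

Lemma mem_partitions_le m n la :
  (la \in partitions_le m n) = is_partition n la && all (geq m) la.
Proof.
elim: m n la => [|m IHm] n la.
  rewrite /is_partition /=; case: la => [|a la] /=; first by case: n.
  case: a => [|a]; last by rewrite !andbF; case: n.
  by rewrite in_cons eqxx andbF; case: n.
apply/idP/idP.
  case/flattenP => _ /mapP[k + ->] /mapP[s + ->].
  rewrite mem_iota add0n ltnS /= => le_k.
  have le_kn : (k * m.+1 <= n)%N by rewrite -leq_divRL.
  rewrite IHm => /andP[/and3P[srt_s s0 /eqP sum_s] le_s].
  apply/andP; split; last first.
    rewrite all_cat all_nseq /= leqnn orbT /=.
    by apply: sub_all le_s => x /= /leqW.
  apply/and3P; split; last by rewrite sumn_cat sumn_nseq sum_s mulnC subnKC.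
    elim: {le_k le_kn sum_s} k => //= k; case: k => [|k] /=.
      by case: s srt_s le_s {s0} => //= x s -> /andP[/leqW-> _].
    by move=> ->; rewrite leqnn.
  by rewrite mem_cat negb_or s0 andbT mem_nseq negb_and orbT.
case/andP=> /and3P[srt la0 /eqP sum_la] le_la.
have [k [s def_la le_s]] : exists k, exists2 s, la = nseq k m.+1 ++ s &
    all (geq m) s.
  elim: la srt le_la {la0 sum_la} => [|x la IHla] /=; first by exists 0%N, [::].
  move=> srt /andP[]; rewrite leq_eqVlt => /predU1P[-> /IHla|lt_x _].
    by case=> [|k [s -> le_s]]; [exact: path_sorted srt | exists k.+1, s].
  exists 0%N, (x :: la) => //=; rewrite -ltnS lt_x /=.
  have tr_geq : transitive geq by move=> a b c /= ab bc; apply: leq_trans bc ab.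
  have /allP ge_x := order_path_min tr_geq srt.
  by apply/allP=> y /ge_x /= /leq_trans; apply.
move: srt la0 sum_la; rewrite {la le_la}def_la => srt.
rewrite mem_cat negb_or sumn_cat sumn_nseq => /andP[_ s0] sum_s.
have srt_s : sorted geq s.
  by elim: (k) srt => //= j IHj /path_sorted.
apply/flattenP.
exists [seq nseq k m.+1 ++ t | t <- partitions_le m (n - k * m.+1)].
  apply/mapP; exists k => //; rewrite mem_iota add0n ltnS /= leq_divRL //.
  by rewrite -sum_s mulnC leq_addr.
apply/mapP; exists s => //; rewrite IHm le_s andbT; apply/and3P; split => //.
by rewrite -sum_s mulnC addKn.
Qed.

Lemma mem_partitions n la : (la \in partitions n) = is_partition n la.
Proof.
rewrite mem_partitions_le; case: (boolP (is_partition n la)) => //=.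
case/and3P=> _ _ /eqP <-; elim: la => //= x la IHla.
rewrite leq_addr /=; apply: sub_all IHla => y /= /leq_trans; apply.
exact: leq_addl.
Qed.

Lemma uniq_partitions_le m n : uniq (partitions_le m n).
Proof.
elim: m n => [|m IHm] n; first by rewrite /=; case: eqP.
pose c (s : seq nat) := count_mem m.+1 s.
have cE k s j : s \in partitions_le m j -> c (nseq k m.+1 ++ s) = k.
  rewrite mem_partitions_le => /andP[_ /allP le_s].
  rewrite /c count_cat count_nseq /= eqxx mul1n (count_memPn _) ?addn0 //.
  by apply/negP => /le_s; rewrite /= ltnn.
suff U r : uniq r -> uniq (flatten [seq [seq nseq k m.+1 ++ s
    | s <- partitions_le m (n - k * m.+1)] | k <- r]) by exact: U (iota_uniq _ _).
elim: r => //= k r IHr /andP[k_r /IHr Ur].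
rewrite cat_uniq Ur andbT map_inj_uniq ?IHm /=; last first.
  by move=> s t /eqP; rewrite eqseq_cat // eqxx => /eqP.
apply/hasPn=> _ /flattenP[_ /mapP[j j_r ->] /mapP[s s_in ->]].
apply/negP=> /mapP[t t_in eq_st]; move: k_r.
by rewrite -(cE k _ _ t_in) -eq_st (cE j _ _ s_in) j_r.
Qed.

Lemma uniq_partitions n : uniq (partitions n).
Proof. exact: uniq_partitions_le. Qed.

(* T is the list of the rows of a Young tableau, from top to bottom; since zip
   truncates to the shorter row, the second condition compares vertically
   adjacent entries. *)
Definition semistandard (T : seq (seq nat)) : bool :=
  all (sorted leq) T
    && sorted (fun r s => all (fun p => (p.1 < p.2)%N) (zip r s)) T.

(* The word 1^la_1 2^la_2 ... *)
Definition content_word (la : seq nat) : seq nat :=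
  tally_seq (zip (iota 1 (size la)) la).

(* The number of semistandard tableaux of shape mu and content la: the fillings
   of shape mu and content la correspond, by reading rows successively, to the
   distinct rearrangements of content_word la. *)
Definition kostka (mu la : seq nat) : nat :=
  count (fun w => semistandard (reshape mu w)) (permutations (content_word la)).

Section Unipotent.

(* {'GL_n[F]} consists of matrices of size n.-1.+1, so n must be positive. *)
Variables (n : nat) (F : finFieldType).

(* reshape_index la i is the index of the diagonal block containing i. *)
Definition parabolic (la : seq nat) : {set {'GL_n[F]}} :=
  [set g : {'GL_n[F]} | [forall i : 'I_n.-1.+1, forall j : 'I_n.-1.+1,
     (reshape_index la j < reshape_index la i)%N ==> (GLval g i j == 0)]].

Lemma group_set_parabolic la : group_set (parabolic la).
Proof.
apply/group_setP; split=> [|g h].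
  rewrite inE; apply/forallP=> i; apply/forallP=> j; apply/implyP=> lt_ji.
  by rewrite GL_1E mxE; case: (eqVneq i j) lt_ji => // ->; rewrite ltnn.
rewrite !inE => /forallP Pg /forallP Ph; apply/forallP=> i; apply/forallP=> j.
apply/implyP=> lt_ji; rewrite GL_ME mxE big1 // => k _.
have [lt_ki | le_ik] := ltnP (reshape_index la k) (reshape_index la i).
  by have /forallP/(_ k)/implyP/(_ lt_ki)/eqP-> := Pg i; rewrite mul0r.
have lt_jk := leq_trans lt_ji le_ik.
by have /forallP/(_ j)/implyP/(_ lt_jk)/eqP-> := Ph k; rewrite mulr0.
Qed.

Canonical parabolic_group la := Group (group_set_parabolic la).

Definition parabolic_char (la : seq nat) : 'CF('GL_n[F]) :=
  'Ind['GL_n[F], parabolic la] 1.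

(* The values of chi on sequences that are not partitions of n are irrelevant. *)
Definition unipotent_chars (chi : seq nat -> 'CF('GL_n[F])) : Prop :=
  (forall mu, is_partition n mu -> chi mu \in irr 'GL_n[F])
  /\ (forall la, is_partition n la ->
        parabolic_char la =
          \sum_(mu <- partitions n) chi mu *+ kostka mu la).

End Unipotent.

Definition marks (gT : finGroupType) (G : {group gT}) (X : seq 'CF(G))
    (K : {group gT}) : Prop :=
  exists2 chi : 'CF(G), chi \in X & '['Res[K] chi, 1]_K > 0.

(* Main.v *)
(** Suppose that K is a proper subgroup of G = GL_4(2) marked by none of the four
unipotent characters.  Then the restriction to K of the permutation character
on complete flags contains the trivial character only once, so that K is
transitive on the 315 flags and |K| = 315 * 2^a.  A subgroup of order 7 of G has
a normalizer of order 21, so Sylow's theorem forces a = 0, 3 or 6, and a = 0 is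
excluded by looking at the Sylow 3- and 5-subgroups.  Thus K has index 8 and G
acts faithfully on G/K as A_8, since every normal subgroup M <> 1 of G has index
dividing 21.

It remains to see that the stabilizer A_7 of a point fixes a nonzero vector in
any irreducible representation of A_8 of degree 7.  For a subgroup H the mean
value over H of the character is the dimension of the space of vectors fixed by
H, hence a natural number.  Applied to suitable subgroups of A_4 x A_4 this
determines the value of the character at a 3-cycle, namely 4; so the fixed space
of a 3-cycle has codimension 2.  As A_7 is generated by three 3-cycles and
2 + 2 + 2 < 7, it fixes a nonzero vector. *)
Require Import Defs.
From mathcomp Require Import all_boot all_order all_algebra all_fingroup.
From mathcomp Require Import all_solvable all_field all_character.
From mathcomp Require Import zify ring.

Set Implicit Arguments.
Unset Strict Implicit.
Unset Printing Implicit Defensive.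

Import Order.TTheory GroupScope GRing.Theory Num.Theory.

(** * Sylow theory in groups of order 20160 with self-centralizing subgroups of order 7 *)

Section Order20160.
Local Open Scope nat_scope.

Lemma card_cent_mod (gT : finGroupType) (p : nat) (P H : {group gT}) :
  p.-group P -> P \subset 'N(H) -> #|'C_H(P)| = #|H| %[mod p].
Proof.
move=> pP nHP; rewrite -afixJ; apply/esym/(@pgroup_fix_mod _ _ _ 'J) => //.
by rewrite astabsJ.
Qed.

Lemma Sylow_card_prime (gT : finGroupType) (p : nat) (G P : {group gT}) :
  prime p -> P \subset G -> #|P| = p -> logn p #|G| = 1%N -> p.-Sylow(G) P.
Proof.
move=> pr_p sPG oP lG; rewrite pHallE sPG oP p_part lG expn1 //=.
Qed.

(** The quotient of the normalizer by the centralizer embeds in the automorphism group of [P], which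
    has order [p - 1] as [P] is cyclic. *)
Lemma card_norm_cent_dvd (gT : finGroupType) (p : nat) (G P : {group gT}) :
  prime p -> #|P| = p -> #|'N_G(P)| %| #|'C_G(P)| * p.-1.
Proof.
move=> pr_p oP; have cP : cyclic P by rewrite prime_cyclic ?oP.
rewrite -(LagrangeI 'N_G(P) 'C(P)).
have -> : 'N_G(P) :&: 'C(P) = 'C_G(P).
  by rewrite -setIA (setIidPr (cent_sub P)).
have -> : p.-1 = #|Aut P| by rewrite card_Aut_cyclic // oP totient_prime.
rewrite dvdn_pmul2l ?cardG_gt0 //.
have <- : #|conj_aut P @* 'N_G(P)| = #|'N_G(P) : 'C(P)|.
  by rewrite card_morphim ker_conj_aut (setIidPr (subsetIr _ _)).
exact: cardSg (Aut_conj_aut _ _).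
Qed.

(** [c], [n] and [i] will be the orders of the centralizer and the normalizer of a Sylow 7-subgroup
    and the number of its conjugates; 7 * 2880 = 20160. Here [c] is 7 or 14 and [n = c * m] with [m]
    dividing 6. The congruence on [i] makes [m] congruent to 5 modulo 7 if [c = 14], which is
    impossible, and to 3 if [c = 7]. *)
Lemma norm_cycle7_arith c n i : 0 < c <= 16 -> 7 %| c -> n %| c * 6 ->
  (n * i = 7 * 2880)%N -> i %% 7 = 1 -> c %| n -> n = 21 /\ c = 7.
Proof.
move=> /andP[c_gt0 le_c] /dvdnP[k def_c]; subst c.
have {le_c} : k < 3 by lia.
case: k c_gt0 => [|[|[|//]]] // _ _ /dvdnP[j ej] eni mi /dvdnP[m em]; subst n.
  have ej' : (j * m = 6)%N by lia.
  have : m < 7 by apply: (@dvdn_leq m 6) => //; apply/dvdnP; exists j; rewrite ej'.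
  by case: m ej' eni ej => [|[|[|[|[|[|[|m]]]]]]] ej' eni ej ltm; lia.
have ej' : (j * m = 6)%N by lia.
have : m < 7 by apply: (@dvdn_leq m 6) => //; apply/dvdnP; exists j; rewrite ej'.
by case: m ej' eni ej => [|[|[|[|[|[|[|m]]]]]]] //=; lia.
Qed.

Lemma norm_cycle7 (gT : finGroupType) (G : {group gT}) (x : gT) :
  #|G| = 2 ^ 6 * 3 ^ 2 * 5 * 7 -> x \in G -> #[x] = 7 -> #|'C_G[x]| <= 16 ->
  #|'N_G(<[x]>)| = 21 /\ #|'C_G[x]| = 7.
Proof.
move=> oG Gx ox leC; have sxG : <[x]> \subset G by rewrite cycle_subG.
have sylP : 7.-Sylow(G) <[x]>.
  by apply: Sylow_card_prime => //; rewrite oG.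
have dvd7 : 7 %| #|'C_G[x]|.
  by rewrite -ox cardSg // subcent1_cycle_sub.
have eqC : 'C_G(<[x]>) = 'C_G[x] by rewrite cent_cycle.
have := card_norm_cent_dvd G (isT : prime 7) ox; rewrite eqC => dvdN.
have := card_Syl_mod G (isT : prime 7); rewrite (card_Syl sylP) => modN.
have idx : (#|'N_G(<[x]>)| * #|G : 'N_G(<[x]>)| = 7 * 2880)%N.
  by rewrite Lagrange ?subsetIl.
have dvdCN : #|'C_G[x]| %| #|'N_G(<[x]>)| by rewrite -eqC cardSg // setIS ?cent_sub.
have C_bound : 0 < #|'C_G[x]| <= 16 by rewrite cardG_gt0.
exact: norm_cycle7_arith C_bound dvd7 dvdN idx modN dvdCN.
Qed.

Section Sylow7.

Variables (gT : finGroupType) (G P : {group gT}).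
Hypothesis oG : #|G| = 2 ^ 6 * 3 ^ 2 * 5 * 7.
Hypothesis sPG : P \subset G.
Hypothesis oP : #|P| = 7.
Hypothesis oN : #|'N_G(P)| = 21.
Hypothesis oC : #|'C_G(P)| = 7.

Lemma pgroup7 : 7.-group P.
Proof. by rewrite /pgroup oP. Qed.

Lemma Sylow7_conj (H : {group gT}) : H \subset G -> 7 %| #|H| ->
  exists2 x, x \in G & P :^ x \subset H.
Proof.
move=> sHG d7; have [y Hy oy] := Cauchy (isT : prime 7) d7.
have sylP : 7.-Sylow(G) P by apply: Sylow_card_prime => //; rewrite oG.
have sy : <[y]> \subset G by rewrite cycle_subG (subsetP sHG).
have p7 : 7.-group <[y]> by rewrite /pgroup -orderE oy.
have [x Gx sx] := Sylow_Jsub sylP sy p7.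
have ex : <[y]> :^ x = P.
  by apply/eqP; rewrite eqEcard sx cardJg -orderE oy oP.
exists x^-1; first by rewrite groupV.
by rewrite -ex -conjsgM mulgV conjsg1 cycle_subG.
Qed.

(** The normalizer in [H] of a Sylow 7-subgroup has order 7 or 21, and its index is 1 modulo 7. *)
Lemma card_dvd7_mod (H : {group gT}) : H \subset G -> 7 %| #|H| ->
  (#|H| %/ 7) %% 7 = 1 \/ (#|H| %/ 7) %% 7 = 3.
Proof.
move=> sHG d7; have [x Gx sPH] := Sylow7_conj sHG d7.
have oPx : #|(P :^ x)%G| = 7 by rewrite cardJg.
have lH : logn 7 #|H| = 1%N.
  apply/eqP; rewrite eqn_leq -pfactor_dvdn ?cardG_gt0 // expn1 d7 andbT.
  by rewrite (leq_trans (dvdn_leq_log 7 _ (cardSg sHG))) ?oG.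
have sylP : 7.-Sylow(H) (P :^ x)%G by apply: Sylow_card_prime.
have := card_Syl_mod H (isT : prime 7); rewrite (card_Syl sylP) => modN.
have idx := Lagrange (subsetIl H 'N((P :^ x)%G)).
have d1 : #|'N_H((P :^ x)%G)| %| 21.
  rewrite -oN -(cardJg 'N_G(P) x) conjIg -normJ (conjGid Gx).
  by apply: cardSg; apply: setSI.
have d2 : 7 %| #|'N_H((P :^ x)%G)|.
  by rewrite -oPx cardSg // subsetI sPH normG.
case/dvdnP: d2 => k ek; rewrite ek in d1 idx.
have d3 : k %| 3 by rewrite -(dvdn_pmul2r (isT : 0 < 7)).
have [_ /(_ _ d3)/orP[]/eqP ek'] := primeP (isT : prime 3); rewrite -idx ek' mulnAC mulnK //.
  by left; rewrite mul1n.
by right; rewrite -modnMmr modN.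
Qed.

(* A Sylow 7-subgroup acts without nontrivial fixed points on the subgroups of
   order prime to 7 that it normalizes. *)
Lemma card_norm7_mod (x : gT) (Q : {group gT}) : x \in G -> Q \subset G ->
  P :^ x \subset 'N(Q) -> ~~ (7 %| #|Q|) -> #|Q| %% 7 = 1.
Proof.
move=> Gx sQG nQP n7.
have pPx : 7.-group (P :^ x) by rewrite pgroupJ pgroup7.
rewrite -(card_cent_mod pPx nQP).
have -> // : #|'C_Q(P :^ x)| = 1%N.
have d1 : #|'C_Q(P :^ x)| %| 7.
  rewrite -oC -(cardJg 'C_G(P) x) conjIg -centJ (conjGid Gx).
  by apply: cardSg; apply: setSI.
have [_ /(_ _ d1)/orP[]/eqP{}d1] := primeP (isT : prime 7).
  exact: d1.
by case/negP: n7; rewrite -d1 cardSg ?subsetIl.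
Qed.

(** Here [#|K| %/ 7 = 45 * 2 ^ a], which is [3 * 2 ^ a] modulo 7, and 2 has order 3 modulo 7. *)
Lemma index_pow2 (K : {group gT}) a : K \subset G -> #|K| = (315 * 2 ^ a)%N ->
  a <= 6 -> a \in [:: 0; 3; 6].
Proof.
move=> sKG oK lea; have := card_dvd7_mod sKG; rewrite oK.
move=> /(_ (dvdn_mulr _ (isT : 7 %| 315))).
by do 7![case: a oK lea => [|a] oK lea; first by case].
Qed.

(** A Sylow 3-subgroup [R] has order 9 and 1 or 7 conjugates, so some [y] of order 5 normalizes it.
    The order of ['C_R(<[y]>)] divides 9 and is 9 modulo 5, so [y] centralizes [R]. Then 45 divides
    the order of the normalizer of [<[y]>], whose index divides 7 and is 1 modulo 5; hence [<[y]>]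
    is normal. But a group of order 7 normalizing it would have to act without nontrivial fixed
    points, and 5 is not 1 modulo 7. *)
Lemma card_neq315 (K : {group gT}) : K \subset G -> #|K| = 315 -> False.
Proof.
move=> sKG oK.
have d7 : 7 %| #|K| by rewrite oK.
have [x Gx sPK] := Sylow7_conj sKG d7.
have normal5 (Q : {group gT}) : 5.-Sylow(K) Q -> Q <| K -> False.
  move=> sylQ nQK; have oQ : #|Q| = 5 by rewrite (card_Hall sylQ) oK p_part.
  have sQG := subset_trans (normal_sub nQK) sKG.
  have nPQ := subset_trans sPK (normal_norm nQK).
  by have := card_norm7_mod Gx sQG nPQ; rewrite oQ => /(_ isT).
have [R sylR] := Sylow_exists 3 K.
have oR : #|R| = 9 by rewrite (card_Hall sylR) oK p_part.
have sRK := pHall_sub sylR.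
have idx3 := card_Syl sylR; have mod3 := card_Syl_mod K (isT : prime 3).
have Lg3 : (#|'N_K(R)| * #|K : 'N_K(R)| = #|K|)%N := Lagrange (subsetIl K 'N(R)).
have d9 : 9 %| #|'N_K(R)| by rewrite -oR cardSg // subsetI sRK normG.
have n5 : 5 %| #|'N_K(R)|.
  case/dvdnP: d9 => k ek; rewrite ek oK in Lg3; rewrite idx3 in mod3.
  have : k %| 35 by apply/dvdnP; exists #|K : 'N_K(R)|; lia.
  rewrite dvdn_divisors // !inE /= => /or4P[]/eqP ek'; rewrite ek ek' //; exfalso.
    by move: mod3; have -> : #|K : 'N_K(R)| = 35 by rewrite ek' in Lg3; lia.
  by move: mod3; have -> : #|K : 'N_K(R)| = 5 by rewrite ek' in Lg3; lia.
have [y NRy oy] := Cauchy (isT : prime 5) n5.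
have [/= Ky nRy] := setIP NRy.
have syl5 : 5.-Sylow(K) <[y]>.
  by apply: Sylow_card_prime; rewrite ?cycle_subG // oK.
have p5 : 5.-group <[y]> by rewrite /pgroup -orderE oy.
have nRY : <[y]> \subset 'N(R) by rewrite cycle_subG.
have dC : #|'C_R(<[y]>)| %| 9 by rewrite -oR cardSg ?subsetIl.
have sRN : R \subset 'N_K(<[y]>).
  suff cRy : 'C_R(<[y]>) = R.
    by rewrite subsetI sRK (subset_trans _ (cent_sub _)) // -cRy subsetIr.
  apply/eqP; rewrite eqEcard subsetIl oR.
  move: dC (card_cent_mod p5 nRY); rewrite oR dvdn_divisors // !inE /=.
  by case/or3P=> /eqP->.
have d9' : 9 %| #|'N_K(<[y]>)| by rewrite -oR cardSg.
have d5' : 5 %| #|'N_K(<[y]>)|.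
  by rewrite -oy cardSg // subsetI cycle_subG Ky normG.
have idx5 := card_Syl syl5; have mod5 := card_Syl_mod K (isT : prime 5).
have Lg5 : (#|'N_K(<[y]>)| * #|K : 'N_K(<[y]>)| = #|K|)%N :=
  Lagrange (subsetIl K 'N(<[y]>)).
have d45 : 45 %| #|'N_K(<[y]>)| by rewrite (@Gauss_dvd 9 5) // d9'.
case/dvdnP: d45 => k ek; rewrite ek oK in Lg5; rewrite idx5 in mod5.
have d7' : k %| 7 by apply/dvdnP; exists #|K : 'N_K(<[y]>)|; clear -Lg5; lia.
have [_ /(_ _ d7')/orP[]/eqP ek'] := primeP (isT : prime 7).
  by rewrite ek' in Lg5; move: mod5; have -> : #|K : 'N_K(<[y]>)| = 7 by clear -Lg5; lia.
apply: normal5 syl5 _; rewrite /normal cycle_subG Ky /=.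
apply/setIidPl/eqP.
by rewrite eqEcard subsetIl oK ek ek'.
Qed.

(** By coprime action [P] normalizes a Sylow p-subgroup of [M] for each prime [p]. Its order must be
    1 modulo 7, which rules out 3, 9 and 5. *)
Lemma normal_7'_pgroup (M : {group gT}) : M <| G -> ~~ (7 %| #|M|) -> 2.-group M.
Proof.
move=> nMG n7; have sMG := normal_sub nMG.
have nPM : P \subset 'N(M) := subset_trans sPG (normal_norm nMG).
have co : coprime #|M| #|P| by rewrite oP coprime_sym prime_coprime.
apply/pgroupP=> p pr_p dp.
have [Q sylQ nQP] := sol_coprime_Sylow_exists p (pgroup_sol pgroup7) nPM co.
have sQM := pHall_sub sylQ; have sQG := subset_trans sQM sMG.
have n7Q : ~~ (7 %| #|Q|) by apply: contra n7 => /dvdn_trans; apply; apply: cardSg.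
have := @card_norm7_mod 1 Q (group1 G) sQG; rewrite conjsg1 => /(_ nQP n7Q).
have pQ : p %| #|Q|.
  by rewrite (card_Hall sylQ) p_part dvdn_exp // logn_gt0 mem_primes pr_p dp cardG_gt0.
have : p \in primes (2 ^ 6 * 3 ^ 2 * 5 * 7).
  by rewrite mem_primes pr_p -oG cardG_gt0 (dvdn_trans pQ) ?cardSg.
have -> : primes (2 ^ 6 * 3 ^ 2 * 5 * 7) = [:: 2; 3; 5; 7] by vm_compute.
have lQ : logn p #|Q| <= logn p (2 ^ 6 * 3 ^ 2 * 5 * 7).
  by rewrite -oG dvdn_leq_log ?cardSg.
have oQ := card_pgroup (pHall_pgroup sylQ).
have l0 : 0 < logn p #|Q| by rewrite logn_gt0 mem_primes pr_p pQ cardG_gt0.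
rewrite !inE => /or4P[]/eqP ep; subst p => //.
- have l3 : logn 3 (2 ^ 6 * 3 ^ 2 * 5 * 7) = 2 by vm_compute.
  rewrite {}l3 in lQ; rewrite {}oQ.
  by move: (logn 3 #|Q|) lQ l0 => [|[|[|l]]].
- have l5 : logn 5 (2 ^ 6 * 3 ^ 2 * 5 * 7) = 1%N by vm_compute.
  rewrite {}l5 in lQ; rewrite {}oQ.
  by move: (logn 5 #|Q|) lQ l0 => [|[|l]].
by rewrite pQ in n7Q.
Qed.

(** By the Frattini argument [G] is the product of [M] and ['N_G(P)], and the latter has order
    21. *)
Lemma normal_7_index (M : {group gT}) : M <| G -> 7 %| #|M| -> #|G : M| %| 21.
Proof.
move=> nMG d7; have sMG := normal_sub nMG.
have [x Gx sPM] := Sylow7_conj sMG d7.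
have sPM' : P \subset M.
  by move: sPM; rewrite sub_conjg (normP _) // groupV (subsetP (normal_norm nMG)).
have sylP : 7.-Sylow(M) P.
  apply: Sylow_card_prime => //; apply/eqP; rewrite eqn_leq.
  rewrite -pfactor_dvdn ?cardG_gt0 // expn1 d7 andbT.
  by rewrite (leq_trans (dvdn_leq_log 7 _ (cardSg sMG))) ?oG.
have := Frattini_arg nMG sylP => defG.
have := mul_cardG M 'N_G(P); rewrite defG oN => eqc.
apply/dvdnP; exists #|M :&: 'N_G(P)|; apply/eqP.
by rewrite -(eqn_pmul2l (cardG_gt0 M)) eqc -(Lagrange sMG) -mulnA [(_ * #|G : M|)%N]mulnC.
Qed.

End Sylow7.
End Order20160.

Local Open Scope ring_scope.

(** * The group GL_4(2): its order, an element of order 7, its normal 2-subgroups *)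

Lemma card_GL42 : #|'GL_4(2)| = (2 ^ 6 * 3 ^ 2 * 5 * 7)%N.
Proof. by rewrite card_GL // card_Fp // unlock. Qed.

Lemma GL_trans (F : finFieldType) (n : nat) (u v : 'rV[F]_n.-1.+1) :
  u != 0 -> v != 0 -> exists g : {'GL_n[F]}, u *m GLval g = v.
Proof.
move=> nz_u nz_v; have /rV0Pn[j uj] := nz_u.
(* [f] has rank one and sends [u] to [v]; as it preserves the rank of [u], some invertible matrix
   agrees with it on [u]. *)
pose f : 'M_n.-1.+1 := delta_mx j 0 *m ((u 0 j)^-1 *: v).
have uf : u *m f = v.
  rewrite mulmxA -colE [col j u]mx11_scalar mxE mul_scalar_mx scalerA divff //.
  by rewrite scale1r.
have [|g Ug eg] := @complete_unitmx _ _ _ u f; first by rewrite uf !rank_rV nz_u nz_v.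
by exists (FinRing.Unit Ug); rewrite -uf eg.
Qed.

Lemma GL42_val_inj : injective (@GLval 4 'F_2).
Proof. exact: val_inj. Qed.

(* The companion matrix of X^4 + X^3 + X^2 + 1 = (X + 1) (X^3 + X + 1). *)
Definition companion7 : 'M['F_2]_(4.-1.+1) :=
  \matrix_(i, j) nth 0 (nth [::] [:: [:: 0; 1; 0; 0]; [:: 0; 0; 1; 0];
    [:: 0; 0; 0; 1]; [:: 1; 0; 1; 1]] i) j.

Definition std_row (i : nat) : 'rV['F_2]_(4.-1.+1) := delta_mx 0 (inord i).

Lemma std_rowE i (j : 'I_4.-1.+1) : (i < 4)%N -> std_row i 0 j = (j == i :> nat)%:R.
Proof. by move=> lti; rewrite mxE eqxx -val_eqE /= inordK. Qed.

Lemma std_row_mul i (A : 'M_(4.-1.+1)) (j : 'I_4.-1.+1) :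
  (std_row i *m A) 0 j = A (inord i) j.
Proof. by rewrite /std_row -rowE mxE. Qed.

Lemma std_row_companion7 i : (i < 3)%N -> std_row i *m companion7 = std_row i.+1.
Proof.
move=> lti; apply/rowP=> j.
rewrite std_row_mul std_rowE // mxE inordK; last exact: ltnW.
by case: i lti => [|[|[|i]]] // _; case: j => [[|[|[|[|j]]]] ltj] //.
Qed.

Lemma std_row3_companion7 :
  std_row 3 *m companion7 = std_row 0 + std_row 2 + std_row 3.
Proof.
apply/rowP=> j; rewrite std_row_mul 2![in RHS]mxE !std_rowE // mxE inordK //.
by case: j => [[|[|[|[|j]]]] ltj] //=; apply/val_inj.
Qed.

(* The first basis vector is cyclic for companion7, so a matrix in the centralizer
   is determined by its first row. *)
Lemma companion7_cyclic (A B : 'M['F_2]_(4.-1.+1)) :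
  A *m companion7 = companion7 *m A -> B *m companion7 = companion7 *m B ->
  std_row 0 *m A = std_row 0 *m B -> A = B.
Proof.
move=> cA cB e0.
have step i : (i < 4)%N -> std_row i *m A = std_row i *m B.
  elim: i => // i IH lti; rewrite -std_row_companion7 // -!mulmxA -cA -cB !mulmxA IH //.
  exact: ltnW.
apply/row_matrixP=> i; have := step i (ltn_ord i).
by rewrite /std_row inord_val -!rowE.
Qed.

Lemma companion7_exp7 : companion7 ^+ 7 = 1.
Proof.
(* Powers of [companion7] commute with it, so it suffices to follow the first basis vector. *)
apply: companion7_cyclic.
- by rewrite mulmxE -exprSr -exprS.
- by rewrite mulmx1 mul1mx.
rewrite !exprS expr0 mulr1 -!mulmxE !mulmxA mulmx1.
have e0 : std_row 0 *m companion7 = std_row 1 by exact: std_row_companion7.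
have e1 : std_row 1 *m companion7 = std_row 2 by exact: std_row_companion7.
have e2 : std_row 2 *m companion7 = std_row 3 by exact: std_row_companion7.
rewrite e0 e1 e2; do 4!rewrite ?mulmxDl ?e0 ?e1 ?e2 ?std_row3_companion7.
apply/rowP=> j.
have D (u v : 'rV['F_2]_4.-1.+1) : (u + v) 0 j = u 0 j + v 0 j by rewrite mxE.
rewrite !D !std_rowE // {e0 e1 e2 D}.
by case: j => [[|[|[|[|j]]]] ltj] //=; apply/val_inj.
Qed.

(** Taking the first row is injective on the centralizer, and there are 2^4 = 16 rows. *)
Lemma exists_cyclic7 : exists2 x : {'GL_4(2)},
  #[x]%g = 7 & (#|'C_('GL_4(2))[x]| <= 16)%N.
Proof.
have /mulmx1_unit[U7 _] : companion7 *m companion7 ^+ 6 = 1%:M.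
  by rewrite mulmxE -exprS companion7_exp7.
pose x : {'GL_4(2)} := FinRing.Unit U7.
exists x.
  apply: nt_prime_order => //.
    by apply: GL42_val_inj; rewrite GL_1E -companion7_exp7.
  apply/eqP=> /(congr1 (@GLval _ _))/matrixP/(_ 0 0).
  by rewrite /= !mxE /= => /eqP.
pose f (g : {'GL_4(2)}) := std_row 0 *m GLval g.
have fI : {in 'C_('GL_4(2))[x] &, injective f}.
  move=> g h /setIP[_ /cent1P cg] /setIP[_ /cent1P ch] efg; apply: GL42_val_inj.
  apply: companion7_cyclic => //.
    by have /(congr1 (@GLval _ _)) := cg; rewrite !GL_MxE.
  by have /(congr1 (@GLval _ _)) := ch; rewrite !GL_MxE.
rewrite -(card_in_imset fI) (leq_trans (max_card _)) // card_mx card_Fp //.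
Qed.

(** In characteristic 2 a 2-group fixes a nonzero vector. The fixed space of a normal subgroup is
    stable under the whole group, which is transitive on nonzero vectors, so everything is fixed. *)
Lemma normal_2group_GL42 (M : {group {'GL_4(2)}}) : M <| 'GL_4(2) -> 2.-group M ->
  M :=: 1%g.
Proof.
move=> nMG pM.
pose rG := GLrepr 'F_2 3.
have sMG := normal_sub nMG.
have nz := rfix_pgroup_pchar (pchar_Fp (isT : prime 2)) rG (isT : 0 < 4)%N pM sMG.
have modF := normal_rfix_mx_module rG nMG.
have [v sv nz_v] := rowV0Pn nz.
have fixw (w : 'rV_4) : (w <= rfix_mx rG M)%MS.
  have [-> | nz_w] := eqVneq w 0; first exact: sub0mx.
  have [g <-] := @GL_trans _ 4 v w nz_v nz_w.
  exact: mxmodule_trans modF (in_setT g) sv.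
apply/trivgP/subsetP=> m Mm; rewrite inE; apply/eqP/GL42_val_inj.
apply/row_matrixP=> i; rewrite GL_1E.
have /rfix_mxP/(_ m Mm) := fixw (delta_mx 0 i).
by rewrite /= -rowE => ->; rewrite rowE mulmx1.
Qed.

(** * Unipotent characters, complete flags and the order of an unmarked subgroup *)

Lemma kostka_trivial mu : mu \in partitions 4 ->
  kostka mu [:: 4]%N = (mu == [:: 4]%N).
Proof.
have /allP H : all (fun mu => kostka mu [:: 4]%N == (mu == [:: 4]%N)) (partitions 4).
  by vm_compute.
by move/H/eqP.
Qed.

(** Over the field of two elements the diagonal consists of ones, so the characteristic polynomial
    is [('X - 1) ^+ 4 = 'X^4 - 1]; Cayley-Hamilton applies. *)
Lemma trig_unipotent (A : 'M['F_2]_4) : is_trig_mx A -> A \in unitmx -> A ^+ 4 = 1.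
Proof.
move=> trA UA.
have diagA i : A i i = 1.
  have : A i i != 0.
    apply: contraTneq UA => Aii; rewrite unitmxE det_trig // (bigD1 i) //= Aii mul0r.
    by rewrite unitr0.
  by case: (A i i) => [[|[|a]] lta] // _; apply: val_inj.
have := Cayley_Hamilton A; rewrite char_poly_trig //.
under eq_bigr do rewrite diagA.
rewrite prodr_const card_ord.
have ch2 : [pchar {poly 'F_2}].-nat (2 ^ 2)%N.
  by rewrite pnatX pnatE // pchar_poly pchar_Fp.
rewrite -polyCN (exprDn_pchar _ _ ch2) -rmorphXn /=.
rewrite rmorphD rmorphXn /= horner_mx_X horner_mx_C => /eqP; rewrite addr_eq0 => /eqP->.
have -> : (-1) ^+ (2 ^ 2) = -1 :> 'F_2 by exact: val_inj.
by rewrite raddfN opprK.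
Qed.

Lemma parabolic_flag_2group : 2.-group (parabolic 4 'F_2 [:: 1; 1; 1; 1]%N).
Proof.
apply/pgroupP=> p pr_p dp; have [g Bg og] := Cauchy pr_p dp.
have g4 : (g ^+ 4 = 1)%g.
  (* [is_trig_mx] means lower triangular, whereas the parabolic subgroup is upper triangular. *)
  have trg : is_trig_mx (GLval g)^T.
    apply/is_trig_mxP=> i j lt_ij; rewrite mxE; apply/eqP.
    move: Bg; rewrite inE => /forallP/(_ j)/forallP/(_ i)/implyP; apply.
    by case: i j lt_ij => [[|[|[|[|i]]]] lti] [[|[|[|[|j]]]] ltj] //.
  have := trig_unipotent trg; rewrite unitmx_tr => /(_ (GL_unit g)) /(congr1 trmx).
  rewrite trmx1 !exprS expr0 mulr1 -!mulmxE !trmx_mul !trmxK => e.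
  by apply: GL42_val_inj; rewrite !expgS expg0 mulg1 !GL_MxE; apply: etrans e; rewrite !mulmxA.
have : (p %| 2 ^ 2)%N by rewrite -og order_dvdn g4.
by rewrite (Euclid_dvdX 2 2 pr_p) andbT dvdn_prime2.
Qed.

Lemma kostka_flag : kostka [:: 4]%N [:: 1; 1; 1; 1]%N = 1%N.
Proof. by vm_compute. Qed.

Lemma partitions4 : partitions 4 =
  [:: [:: 1; 1; 1; 1]; [:: 2; 1; 1]; [:: 2; 2]; [:: 3; 1]; [:: 4]]%N.
Proof. by vm_compute. Qed.

Lemma parabolic_full (n : nat) (F : finFieldType) : (0 < n)%N ->
  parabolic n F [:: n] = 'GL_n[F].
Proof.
case: n => // n _; apply/setP=> g; rewrite !inE; apply/forallP=> i; apply/forallP=> j.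
by rewrite /reshape_index /= !subn_eq0 (ltn_ord i).
Qed.

(* The left-hand side counts the (K, H)-double cosets: summing over K * H alone
   the numbers of fixed points gives 1 already. *)
Lemma ind1_fixed_mulG (gT : finGroupType) (G H K : {group gT}) :
  H \subset G -> K \subset G -> '['Res[K] ('Ind[G, H] 1), 1]_K = 1 ->
  (K * H)%g = G.
Proof.
move=> sHG sKG; rewrite cfdotE.
under eq_bigr => x Kx.
  rewrite cfResE // cfIndE // cfun1E Kx conjC1 mulr1.
  under eq_bigr do rewrite cfun1E.
  over.
rewrite -mulr_sumr exchange_big /=.
pose f (y : gT) := (\sum_(x in K) ((x ^ y)%g \in H))%N.
under eq_bigr => y Gy do rewrite -natr_sum -/(f y).
rewrite -natr_sum mulrA -invfM -natrM => eq1.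
have {eq1} sumf : (\sum_(y in G) f y = #|K| * #|H|)%N.
  have nz : (#|K| * #|H|)%:R != 0 :> algC.
    by rewrite pnatr_eq0 -lt0n muln_gt0 !cardG_gt0.
  move/(congr1 ( *%R (#|K| * #|H|)%:R)): eq1.
  by rewrite mulrA divff // mul1r mulr1 => /eqP; rewrite eqr_nat => /eqP.
have sKHG : (K * H)%g \subset G by rewrite mul_subG.
have fKH y : y \in (K * H)%g -> f y = #|K :&: H|.
  case/mulsgP=> k h Kk Hh ->.
  rewrite /f (reindex_inj (conjg_inj k^-1%g)) /=.
  rewrite -sum1_card big_mkcond [RHS]big_mkcond; apply: eq_bigr => x _.
  rewrite memJ_norm ?(subsetP (normG K)) ?groupV // conjgM conjgKV.
  rewrite (memJ_norm _ (subsetP (normG H) _ Hh)) inE.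
  by case: (x \in K); case: (x \in H).
apply/eqP; rewrite eqEsubset sKHG /=; apply/subsetP=> y Gy.
apply: contraTT isT => nKHy.
have : (#|K| * #|H| < \sum_(y in G) f y)%N.
  rewrite (bigID (mem (K * H)%g)) /= mul_cardG.
  have -> : (\sum_(i in G | i \in (K * H)%g) f i = #|(K * H)%g| * #|K :&: H|)%N.
    rewrite -sum_nat_const; apply: eq_big => [z|z /andP[_ /fKH //]].
    by rewrite andb_idl // => /(subsetP sKHG).
  (* Outside [K * H] the element [y] contributes at least the term of the identity. *)
  rewrite -addn1 leq_add2l (bigD1 y) ?Gy //= /f (bigD1 1%g) //=.
  by rewrite conj1g group1.
by rewrite sumf ltnn.
Qed.

(** The parabolic subgroup of (4) is the whole group, and (4) is the only shape with a tableau of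
    content (4). *)
Lemma unipotent_trivial (chi : seq nat -> 'CF('GL_4(2))) :
  unipotent_chars chi -> chi [:: 4]%N = 1.
Proof.
case=> _ /(_ [:: 4]%N isT).
rewrite (eq_big_seq (fun mu => chi mu *+ (mu == [:: 4]%N))); last first.
  by move=> mu /kostka_trivial->.
rewrite partitions4 !big_cons big_nil /= !mulr0n mulr1n !add0r addr0 => <-.
by rewrite /parabolic_char parabolic_full // cfInd_id.
Qed.

(** In the character induced from the flag stabilizer only the trivial constituent, of Kostka number
    1, contributes to the multiplicity of the trivial character of [K]. *)
Lemma unmarked_mulG (chi : seq nat -> 'CF('GL_4(2))) (K : {group {'GL_4(2)}}) :
    unipotent_chars chi ->
    {in [:: [:: 1; 1; 1; 1]; [:: 2; 1; 1]; [:: 2; 2]; [:: 3; 1]]%N,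
      forall mu, '['Res[K] (chi mu), 1]_K = 0} ->
  (K * parabolic 4 'F_2 [:: 1; 1; 1; 1]%N)%g = 'GL_4(2).
Proof.
move=> uchi chi0.
have sBG : parabolic 4 'F_2 [:: 1; 1; 1; 1]%N \subset 'GL_4(2) by exact: subsetT.
apply: (@ind1_fixed_mulG _ _ (parabolic_group _ _ _)) => //; first exact: subsetT.
have := uchi.2 [:: 1; 1; 1; 1]%N isT; rewrite /parabolic_char => /= ->.
rewrite partitions4 !big_cons big_nil addr0 !(raddfD, raddfMn) /=.
rewrite !cfdotDl !cfdotMnl unipotent_trivial // cfRes_cfun1 ?cfnorm1 // kostka_flag.
by rewrite !chi0 // ?mul0rn ?addr0 ?add0r.
Qed.

(** The flag stabilizer is a 2-group, so the factorization puts the odd part 315 of the group order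
    into the order of [K]. *)
Lemma unmarked_card (chi : seq nat -> 'CF('GL_4(2))) (K : {group {'GL_4(2)}}) :
    unipotent_chars chi ->
    {in [:: [:: 1; 1; 1; 1]; [:: 2; 1; 1]; [:: 2; 2]; [:: 3; 1]]%N,
      forall mu, '['Res[K] (chi mu), 1]_K = 0} ->
  exists2 a, (a <= 6)%N & #|K| = (315 * 2 ^ a)%N.
Proof.
move=> uchi chi0; have defG := unmarked_mulG uchi chi0.
have := mul_cardG K (parabolic_group 4 'F_2 [:: 1; 1; 1; 1]%N).
rewrite defG card_GL42 => eqc.
have [b oB] := p_natP parabolic_flag_2group; rewrite /= in oB eqc.
rewrite oB in eqc.
have d315 : (315 %| #|K|)%N.
  rewrite -(@Gauss_dvdl _ _ (2 ^ b)) ?coprimeXr // eqc dvdn_mulr //.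
case/dvdnP: d315 => k oK.
have : (k %| 2 ^ 6)%N.
  rewrite -(@dvdn_pmul2r 315) // -oK.
  have <- : (2 ^ 6 * 3 ^ 2 * 5 * 7 = 2 ^ 6 * 315)%N by lia.
  by rewrite -card_GL42 cardSg ?subsetT.
by case/(dvdn_pfactor _ _ (isT : prime 2)) => a lea ka; exists a; rewrite // oK ka mulnC.
Qed.

Lemma normal_GL42 (M : {group {'GL_4(2)}}) : M <| 'GL_4(2) ->
  M :=: 1%g \/ (#|'GL_4(2) : M| %| 21)%N.
Proof.
have [x ox leC] := exists_cyclic7.
have [oN oC] := norm_cycle7 card_GL42 (in_setT x) ox leC.
have sPG : <[x]> \subset 'GL_4(2) by exact: subsetT.
have oC' : #|'C_('GL_4(2))(<[x]>)| = 7%N by rewrite cent_cycle.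
move=> nMG; have [d7|n7] := boolP (7 %| #|M|)%N.
  by right; apply: (normal_7_index card_GL42 sPG ox oN nMG d7).
left; apply: normal_2group_GL42 => //.
exact: (normal_7'_pgroup card_GL42 sPG ox oC' nMG n7).
Qed.

Lemma unmarked_card2520 (chi : seq nat -> 'CF('GL_4(2))) (K : {group {'GL_4(2)}}) :
    unipotent_chars chi ->
    {in [:: [:: 1; 1; 1; 1]; [:: 2; 1; 1]; [:: 2; 2]; [:: 3; 1]]%N,
      forall mu, '['Res[K] (chi mu), 1]_K = 0} ->
  K \proper 'GL_4(2) -> #|K| = (315 * 8)%N.
Proof.
move=> uchi chi0 prK; have [a lea oK] := unmarked_card uchi chi0.
have [x ox leC] := exists_cyclic7.
have [oN oC] := norm_cycle7 card_GL42 (in_setT x) ox leC.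
have sPG : <[x]> \subset 'GL_4(2) by exact: subsetT.
have oC' : #|'C_('GL_4(2))(<[x]>)| = 7%N by rewrite cent_cycle.
have := index_pow2 card_GL42 sPG ox oN (subsetT _) oK lea.
rewrite !inE => /or3P[]/eqP ea; rewrite ea in oK.
- by case: (card_neq315 card_GL42 sPG ox oN oC' (subsetT K)); rewrite oK.
- exact: oK.
(* The exponent 6 would make [K] the whole group. *)
move/proper_card: prK; rewrite oK card_GL42.
by rewrite (_ : 2 ^ 6 * 3 ^ 2 * 5 * 7 = 315 * 2 ^ 6)%N ?ltnn.
Qed.

(** * Computations with permutations of 8 points *)

Section Lists.
Local Open Scope nat_scope.

(* A list s of length 8 encodes the permutation i |-> nth 0 s i of {0, ..., 7};
   products are read from left to right, as in {perm 'I_8}. *)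
Definition lcomp (s t : seq nat) : seq nat := [seq nth 0 t i | i <- s].
Definition lid : seq nat := [:: 0; 1; 2; 3; 4; 5; 6; 7].
Definition lsq (s : seq nat) : seq nat := lcomp s s.
Definition is_lperm (s : seq nat) : bool := perm_eq s lid.

(** Groups are entered as products of small sets, one factor being chosen from each. *)
Definition lprod (xss : seq (seq (seq nat))) : seq (seq nat) :=
  foldr (fun xs ys => [seq lcomp x y | x <- xs, y <- ys]) [:: lid] xss.

(* In cycle notation: pa1 = (01)(23), pb1 = (45)(67), pc1 = (012), pc2 = (234),
   pc3 = (456). *)
Definition pa1 := [:: 1; 0; 3; 2; 4; 5; 6; 7].
Definition pa2 := [:: 2; 3; 0; 1; 4; 5; 6; 7].
Definition pb1 := [:: 0; 1; 2; 3; 5; 4; 7; 6].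
Definition pb2 := [:: 0; 1; 2; 3; 6; 7; 4; 5].
Definition pab1 := [:: 1; 0; 3; 2; 5; 4; 7; 6].
Definition pab2 := [:: 2; 3; 0; 1; 6; 7; 4; 5].
Definition pc1 := [:: 1; 2; 0; 3; 4; 5; 6; 7].
Definition pc2 := [:: 0; 1; 3; 4; 2; 5; 6; 7].
Definition pc3 := [:: 0; 1; 2; 3; 5; 6; 4; 7].
Definition pcc := [:: 1; 2; 0; 3; 5; 6; 4; 7].
(* pt1, pt2 and pt3 fuse classes of A_4 x A_4; pu1, pu2 and pu3 conjugate pa1 to
   pt1, pc1 to pc2 and pc1 to pc3. *)
Definition pt1 := [:: 0; 2; 1; 3; 5; 4; 6; 7].
Definition pt2 := [:: 4; 5; 6; 7; 0; 1; 2; 3].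
Definition pt3 := [:: 0; 1; 2; 7; 5; 4; 6; 3].
Definition pu1 := [:: 4; 5; 1; 2; 3; 6; 0; 7].
Definition pu2 := [:: 2; 3; 4; 0; 1; 5; 6; 7].
Definition pu3 := [:: 4; 5; 6; 2; 0; 1; 3; 7].

(* Square roots of all the permutations above and of their squares: squares lie in
   every subgroup of index 2 of S_8. *)
Definition sqroots : seq (seq nat) :=
  [:: lid; [:: 2; 3; 1; 0; 4; 5; 6; 7]; [:: 1; 2; 3; 0; 4; 5; 6; 7];
      [:: 0; 1; 2; 3; 6; 7; 5; 4]; [:: 0; 1; 2; 3; 5; 6; 7; 4];
      [:: 2; 3; 1; 0; 6; 7; 5; 4]; [:: 1; 2; 3; 0; 5; 6; 7; 4];
      pc1; pc2; pc3; pcc; lsq pc1; lsq pc2; lsq pc3; lsq pcc;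
      [:: 0; 4; 5; 3; 2; 1; 6; 7]; [:: 1; 4; 3; 6; 5; 0; 7; 2];
      [:: 0; 1; 2; 5; 3; 7; 6; 4]; [:: 1; 4; 0; 6; 5; 3; 2; 7];
      [:: 1; 2; 3; 4; 0; 5; 6; 7]; [:: 1; 4; 3; 6; 5; 0; 2; 7]].

Definition cyc3 c := [:: lid; c; lsq c].
Definition V4a := [:: [:: lid; pa1]; [:: lid; pa2]].
Definition V4b := [:: [:: lid; pb1]; [:: lid; pb2]].
Definition V4diag := [:: [:: lid; pab1]; [:: lid; pab2]].
Definition A4A4 := V4a ++ cyc3 pc1 :: V4b ++ [:: cyc3 pc3].

(** Candidates for conjugating elements, all products of squares; that they reach every element of
    the test subgroups is part of [test_subgroupsP]. *)
Definition conjugators : seq (seq nat) :=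
  lprod ([:: [:: lid; pt3]; [:: lid; pt2]; [:: lid; pt1]] ++ A4A4)
  ++ lprod [:: [:: lid; pt1]; [:: pu1; pu2; pu3]; cyc3 pc1; cyc3 pc3].

(** The cycle types are 1, 2^2, 2^4, 3, 3.2^2 and 3^2, those occurring in A_4 x A_4. *)
Definition class_reps := [:: lid; pa1; pab1; pc1; lcomp pc1 pb1; pcc].

Definition lfix (s : seq nat) : nat := count (fun i => nth 0 s i == i) lid.

(** The fixed points of [s] and of its square separate the six cycle types, and [u] witnesses
    conjugacy. If the search fails the value is 6, which [subgroup_check] rejects. *)
Definition lclass (us : seq (seq nat)) (s : seq nat) : nat :=
  find (fun r => [&& lfix r == lfix s, lfix (lsq r) == lfix (lsq s) &
    has (fun u => lcomp u s == lcomp r u) us]) class_reps.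

(** Stability under left multiplication by the factors makes the mean over the list invariant under
    every element of the list. *)
Definition lclosed (gss : seq (seq (seq nat))) : bool :=
  let l := lprod gss in
  (0 < size l) && all (fun g => let gl := map (lcomp g) l in uniq gl && all (mem l) gl)
     (flatten gss).

(* The subgroups, given as products, with the numbers of their elements in the
   classes of class_reps. *)
Definition test_subgroups : seq (seq (seq (seq nat)) * seq nat) :=
  [:: ([:: [:: lid; pa1]], [:: 1; 1; 0; 0; 0; 0]);
      ([:: [:: lid; pab1]], [:: 1; 0; 1; 0; 0; 0]);
      (V4a, [:: 1; 3; 0; 0; 0; 0]);
      (V4diag, [:: 1; 0; 3; 0; 0; 0]);
      (V4a ++ V4b, [:: 1; 6; 9; 0; 0; 0]);
      ([:: cyc3 pc1], [:: 1; 0; 0; 2; 0; 0]);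
      ([:: cyc3 pc2], [:: 1; 0; 0; 2; 0; 0]);
      ([:: cyc3 pc3], [:: 1; 0; 0; 2; 0; 0]);
      ([:: cyc3 pcc], [:: 1; 0; 0; 0; 0; 2]);
      ([:: cyc3 pc1; [:: lid; pt1]], [:: 1; 3; 0; 2; 0; 0]);
      ([:: cyc3 pcc; [:: lid; pt1]], [:: 1; 3; 0; 0; 0; 2]);
      ([:: cyc3 pc1; [:: lid; pb1]], [:: 1; 1; 0; 2; 2; 0]);
      (V4a ++ cyc3 pc1 :: V4b, [:: 1; 6; 9; 8; 24; 0]);
      (A4A4, [:: 1; 6; 9; 16; 48; 64])].

Definition subgroup_check us (x : seq (seq (seq nat)) * seq nat) : bool :=
  let ks := map (lclass us) (lprod x.1) in
  [&& all (mem (map lsq sqroots)) (flatten x.1), lclosed x.1,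
      all (fun k => k < 6) ks & [seq count_mem k ks | k <- iota 0 6] == x.2].

Lemma test_subgroupsP : let us := conjugators in all (subgroup_check us) test_subgroups.
Proof. by vm_compute. Qed.

Lemma sqroots_perm : all is_lperm sqroots. Proof. by vm_compute. Qed.

Definition lword (ks : seq nat) : seq nat :=
  foldr lcomp lid (map (nth lid [:: pc1; pc2; pc3]) ks).

(* Words in pc1, pc2, pc3 giving transversals of A_3 > 1, A_4 > A_3, ..., A_7 > A_6. *)
Definition A7_transversals : seq (seq (seq nat)) :=
  [:: [:: [::]; [:: 0]; [:: 0; 0]];
      [:: [::]; [:: 1; 1; 0; 1]; [:: 1; 1; 0; 0; 1]; [:: 1; 1; 0; 0; 1; 0]];
      [:: [::]; [:: 1]; [:: 1; 0]; [:: 1; 1]; [:: 1; 0; 0]];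
      [:: [::]; [:: 2; 2; 1; 2]; [:: 2; 2; 1; 0; 2]; [:: 2; 2; 1; 1; 2];
          [:: 2; 2; 1; 0; 0; 2]; [:: 2; 2; 1; 1; 2; 1]];
      [:: [::]; [:: 2]; [:: 2; 1]; [:: 2; 2]; [:: 2; 1; 0]; [:: 2; 1; 1];
          [:: 2; 1; 0; 0]]].

Definition lA7 : seq (seq nat) := lprod (map (map lword) A7_transversals).

(** As 2520 is the order of A_7, the words exhaust the stabilizer of the point 7 in A_8. *)
Lemma lA7P : [&& size lA7 == 2520, uniq lA7 & all (fun s => nth 0 s 7 == 7) lA7].
Proof. by vm_compute. Qed.

End Lists.

(** * Arithmetic of the dimensions of fixed spaces *)

Lemma eq_lincomb (R : pzRingType) (k a b c d : R) : a = b -> c - d = k * (a - b) -> c = d.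
Proof. by move=> ->; rewrite subrr mulr0 => /subr0_eq. Qed.

(* The d's are dimensions of spaces of fixed vectors, and x, y, z, w, r are the values
   of the character at elements of cycle type 2^2, 2^4, 3, 3.2^2, 3^2. *)
Lemma degree7_arith (C : numFieldType) (x y z w r : C)
    (da db dV dD dE dC dS dCC dSC d6 d48 d144 : nat) :
  (da <= 7)%N -> (db <= 7)%N -> (dC <= 7)%N -> (d48 <= dE)%N -> (d144 <= dE)%N ->
  x != 7 -> y != 7 -> z != 7 ->
  7 + x = (2 * da)%:R ->
  7 + y = (2 * db)%:R ->
  7 + x *+ 3 = (4 * dV)%:R ->
  7 + y *+ 3 = (4 * dD)%:R ->
  7 + x *+ 6 + y *+ 9 = (16 * dE)%:R ->
  7 + z *+ 2 = (3 * dC)%:R ->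
  7 + x *+ 3 + z *+ 2 = (6 * dS)%:R ->
  7 + r *+ 2 = (3 * dCC)%:R ->
  7 + x *+ 3 + r *+ 2 = (6 * dSC)%:R ->
  7 + x + z *+ 2 + w *+ 2 = (6 * d6)%:R ->
  7 + x *+ 6 + y *+ 9 + z *+ 8 + w *+ 24 = (48 * d48)%:R ->
  7 + x *+ 6 + y *+ 9 + z *+ 16 + w *+ 48 + r *+ 64 = (144 * d144)%:R ->
  dC = 5%N.
Proof.
move=> le_a le_b le_C le48 le144 nx ny nz Ea Eb.
(* Throughout, [eq_lincomb] turns a linear consequence of a hypothesis into an identity with
   multiplier [k], left to [ring] or [field]. *)
have {Ea} def_x : x = 2 * da%:R - 7 by apply: (eq_lincomb (k := 1) Ea); ring.
have {Eb} def_y : y = 2 * db%:R - 7 by apply: (eq_lincomb (k := 1) Eb); ring.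
rewrite def_x def_y in nx ny *.
have {nx} na : da <> 7%N by move=> e; case/eqP: nx; rewrite e; ring.
have {ny} nb : db <> 7%N by move=> e; case/eqP: ny; rewrite e; ring.
move=> EV ED EE.
have {EV} NV : (6 * da = 4 * dV + 14)%N.
  by apply/eqP; rewrite -(eqr_nat C); apply/eqP; apply: (eq_lincomb (k := 1) EV); ring.
have {ED} ND : (6 * db = 4 * dD + 14)%N.
  by apply/eqP; rewrite -(eqr_nat C); apply/eqP; apply: (eq_lincomb (k := 1) ED); ring.
have {EE} NE : (12 * da + 18 * db = 16 * dE + 98)%N.
  by apply/eqP; rewrite -(eqr_nat C); apply/eqP; apply: (eq_lincomb (k := 1) EE); ring.
(* [NV] and [ND] leave 3 and 5 for [da] and [db], since 7 is excluded; [NE] then selects this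
   pair. *)
have [ea [eb eE]] : da = 5%N /\ db = 3%N /\ dE = 1%N by lia.
rewrite {}ea {}eb {}eE {NV ND NE def_x def_y na nb le_a le_b} in le48 le144 *.
move=> EC; have {EC} def_z : z = (3 * dC%:R - 7) / 2.
  by apply: (eq_lincomb (k := 1 / 2) EC); field.
move=> + ECC; have {ECC} def_r : r = (3 * dCC%:R - 7) / 2.
  by apply: (eq_lincomb (k := 1 / 2) ECC); field.
rewrite {}def_r {}def_z in nz * => ES ESC E6.
have {nz} nC : dC <> 7%N by move=> e; case/eqP: nz; rewrite e; field.
have {E6} def_w : w = (6 * d6%:R - 3 * dC%:R - 3) / 2.
  by apply: (eq_lincomb (k := 1 / 2) E6); field.
rewrite {}def_w => E48 E144.
have {ES} NS : (3 * dC + 9 = 6 * dS)%N.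
  by apply/eqP; rewrite -(eqr_nat C); apply/eqP; apply: (eq_lincomb (k := 1) ES); field.
have {ESC} NSC : (3 * dCC + 9 = 6 * dSC)%N.
  by apply/eqP; rewrite -(eqr_nat C); apply/eqP; apply: (eq_lincomb (k := 1) ESC); field.
have {E48} N48 : (72 * d6 = 48 * d48 + 48 + 24 * dC)%N.
  by apply/eqP; rewrite -(eqr_nat C); apply/eqP; apply: (eq_lincomb (k := 1) E48); field.
have {E144} N144 : (144 * d6 + 96 * dCC = 144 * d144 + 336 + 48 * dC)%N.
  by apply/eqP; rewrite -(eqr_nat C); apply/eqP; apply: (eq_lincomb (k := 1) E144); field.
(* [N48] and [N144] give [2 * dCC + 2 * d48 = 3 * d144 + 5]. Here [dCC] is odd and [d48], [d144] are
   at most 1, so both equal 1. Then [3 * d6 = dC + 4], and 5 is the only odd value of [dC] below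
   7. *)
lia.
Qed.

(** In a full-rank factorization [e = C *m R], idempotency cancels to [R *m C = 1], whose size is
    the rank of [e]. *)
Lemma mxtrace_idem (F : fieldType) (n : nat) (e : 'M[F]_n) :
  e *m e = e -> \tr e = (\rank e)%:R.
Proof.
have := mulmx_base e; have := row_base_free e; have := col_base_full e.
move: (col_base e) (row_base e) => C R fullC freeR def_e.
rewrite -{1 2 3 4}def_e => idem_e.
rewrite mxtrace_mulC; suff -> : R *m C = 1%:M by rewrite mxtrace1.
apply: (row_free_inj freeR); apply: (row_full_inj fullC).
by rewrite /= mul1mx -idem_e !mulmxA.
Qed.

Lemma bigop_count (V : zmodType) (X : nat -> V) (n : nat) (s : seq nat) :
  all (fun k => (k < n)%N) s ->
  \sum_(k <- s) X k = \sum_(0 <= k < n) X k *+ count_mem k s.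
Proof.
elim: s => [_|a s IHs /= /andP[lt_an /IHs {}IHs]]; first by rewrite big_nil big1.
rewrite big_cons IHs; under [RHS]eq_bigr do rewrite mulrnDr.
rewrite big_split /=; congr (_ + _).
rewrite (big_rem a) ?mem_index_iota //= eqxx big1_seq ?addr0 // => i.
by rewrite mem_rem_uniq ?iota_uniq // inE => /andP[_ /andP[/negbTE]]; rewrite eq_sym => ->.
Qed.

(** * Averages over listed groups in a representation, and a common fixed vector *)

Section Average.

Variables (n : nat) (V : seq nat -> 'M[algC]_n) (good : seq nat -> Prop).
Hypothesis goodM : forall s t, good s -> good t -> good (lcomp s t).
Hypothesis VM : forall s t, good s -> good t -> V (lcomp s t) = V s *m V t.
Hypothesis good_sq : forall s, is_lperm s -> good (lsq s).
Hypothesis V1 : V lid = 1%:M.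
Hypothesis V_unit : forall s, good s -> V s \in unitmx.
Hypothesis V_faithful : forall s, good s -> \tr (V s) = n%:R -> s = lid.

(** When [l] lists a group this is the projection onto its fixed column vectors. *)
Definition avg (l : seq (seq nat)) : 'M[algC]_n :=
  (size l)%:R^-1 *: \sum_(s <- l) V s.

Lemma good_id : good lid.
Proof. exact: (good_sq (s := lid)). Qed.

Lemma good_sqroots gs : all (mem (map lsq sqroots)) gs -> {in gs, forall s, good s}.
Proof.
move=> /allP sgs s /sgs /mapP[p p_in ->]; apply: good_sq.
exact: (allP sqroots_perm).
Qed.

Lemma lprod_ind (P : seq nat -> Prop) gss : P lid ->
    (forall s t, P s -> P t -> P (lcomp s t)) ->
  {in flatten gss, forall s, P s} -> {in lprod gss, forall s, P s}.
Proof.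
move=> P1 PM; elim: gss => [_ s|gs gss IH Pg _ /allpairsP[[x y] /= [gx ly ->]]].
  by rewrite inE => /eqP->.
apply: PM; first by apply: Pg; rewrite /= mem_cat gx.
by apply: IH => // s gs_s; apply: Pg; rewrite /= mem_cat gs_s orbT.
Qed.

(** Invariance passes to products, and left multiplication by a factor permutes the list. *)
Lemma mul_avg gss : lclosed gss -> {in flatten gss, forall s, good s} ->
  {in lprod gss, forall s, V s *m avg (lprod gss) = avg (lprod gss)}.
Proof.
move=> /andP[_ /allP cl] good_g s ls.
have good_l := lprod_ind good_id goodM good_g.
suff : good s /\ V s *m avg (lprod gss) = avg (lprod gss) by case.
move: s ls; apply: lprod_ind => [|s t [gs es] [gt et]|s g_s].
- by split; [exact: good_id | rewrite V1 mul1mx].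
- by split; [exact: goodM | rewrite VM // -mulmxA et].
split; first exact: good_g.
rewrite -scalemxAr; congr (_ *: _); rewrite mulmx_sumr.
have /andP[uniq_sl /allP sub_sl] := cl s g_s.
have [uniq_l eq_l] : uniq (lprod gss) /\ map (lcomp s) (lprod gss) =i lprod gss.
  have le : (size (lprod gss) <= size (map (lcomp s) (lprod gss)))%N by rewrite size_map.
  have [_ eq_l] := uniq_min_size uniq_sl sub_sl le; split=> //.
  by rewrite -(eq_uniq _ eq_l) // size_map.
rewrite -[RHS](perm_big _ (uniq_perm uniq_sl uniq_l eq_l)) /= big_map.
by apply: eq_big_seq => t lt; rewrite VM //; [exact: good_g | exact: good_l].
Qed.

Lemma avg_idem gss : lclosed gss -> {in flatten gss, forall s, good s} ->
  avg (lprod gss) *m avg (lprod gss) = avg (lprod gss).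
Proof.
move=> cl good_g; have := mul_avg cl good_g; case/andP: cl => gt0 _.
move: (lprod gss) gt0 => l gt0 eql.
rewrite {1}/avg -scalemxAl mulmx_suml (eq_big_seq _ eql).
rewrite big_tnth sumr_const card_ord -scaler_nat scalerA mulVf ?scale1r //.
by rewrite pnatr_eq0 -lt0n.
Qed.

Lemma sum_trace_rank gss : lclosed gss -> {in flatten gss, forall s, good s} ->
  \sum_(s <- lprod gss) \tr (V s) = (size (lprod gss) * \rank (avg (lprod gss)))%:R.
Proof.
move=> cl good_g; have := avg_idem cl good_g => /mxtrace_idem.
rewrite mxtraceZ raddf_sum /= natrM => <-; rewrite mulVKf //.
by case/andP: cl => gt0 _; rewrite pnatr_eq0 -lt0n.
Qed.

Lemma trace_conj u s r : good u -> good s -> good r -> lcomp u s = lcomp r u ->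
  \tr (V s) = \tr (V r).
Proof.
move=> gu gs gr /(congr1 V); rewrite !VM // => e.
have Uu := V_unit gu.
by rewrite -(mulKmx Uu (V s)) e mxtrace_mulC mulmxK.
Qed.

Lemma good_reps k : good (nth lid class_reps k).
Proof.
have g := good_sqroots (_ : all (mem (map lsq sqroots)) [:: pa1; pab1; pc1; pb1; pcc]).
have {}g s : s \in [:: pa1; pab1; pc1; pb1; pcc] -> good s by apply: g; vm_compute.
case: k => [|[|[|[|[|[|k]]]]]]; [exact: good_id | exact: (g pa1) | exact: (g pab1)
  | exact: (g pc1) | exact: (goodM (g pc1 isT) (g pb1 isT)) | exact: (g pcc) |].
by rewrite nth_default //; exact: good_id.
Qed.

Lemma good_conjugators : {in conjugators, forall s, good s}.
Proof.
have H gss : all (mem (map lsq sqroots)) (flatten gss) -> {in lprod gss, forall s, good s}.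
  by move=> sq_gss; apply: lprod_ind good_id goodM _; apply: good_sqroots.
move=> s; rewrite mem_cat => /orP[]; apply: H; vm_compute => //.
Qed.

Lemma subgroup_good gss cs : (gss, cs) \in test_subgroups ->
  lclosed gss /\ {in flatten gss, forall s, good s}.
Proof.
move/(allP test_subgroupsP) => /and4P[sq_gss cl _ _]; split=> //; exact: good_sqroots.
Qed.

(** Each listed element is conjugate, by a good permutation, to its representative, so the traces
    can be grouped by class. *)
Lemma class_sum gss cs : (gss, cs) \in test_subgroups ->
  \sum_(0 <= k < 6) \tr (V (nth lid class_reps k)) *+ nth 0 cs k =
  (size (lprod gss) * \rank (avg (lprod gss)))%:R.
Proof.
move=> in_sub; have [cl good_g] := subgroup_good in_sub.
rewrite -sum_trace_rank //.
have /and4P[_ _] := allP test_subgroupsP _ in_sub; rewrite /fst /snd.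
set ks := map _ _ => lt_ks /eqP eq_cs.
transitivity (\sum_(k <- ks) \tr (V (nth lid class_reps k))).
  rewrite (bigop_count _ lt_ks); apply: eq_big_nat => k /andP[_ lt_k6].
  by rewrite -eq_cs (nth_map 0) ?size_iota // nth_iota.
rewrite big_map; apply: eq_big_seq => s ls.
have lt6 : (lclass conjugators s < 6)%N by apply: (allP lt_ks); apply: map_f.
move: lt6; rewrite {1}/lclass -[6%N]/(size class_reps) -has_find => /(nth_find lid)
  /and3P[_ _ /hasP[u us /eqP e]].
apply/esym/(trace_conj (good_conjugators us) _ (good_reps _) e).
exact: (lprod_ind good_id goodM good_g).
Qed.

Lemma rank_avg_sub gss1 gss2 : lclosed gss1 -> lclosed gss2 ->
    {in flatten gss2, forall s, good s} ->
    {subset lprod gss1 <= lprod gss2} ->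
  (\rank (avg (lprod gss2)) <= \rank (avg (lprod gss1)))%N.
Proof.
move=> /andP[gt0 _] cl good_g sub.
have e : avg (lprod gss1) *m avg (lprod gss2) = avg (lprod gss2).
  have := mul_avg cl good_g; move: (avg (lprod gss2)) => A eqA.
  rewrite /avg -scalemxAl mulmx_suml.
  rewrite (eq_big_seq (fun=> A)); last by move=> s /sub /eqA.
  rewrite big_tnth sumr_const card_ord -scaler_nat scalerA mulVf ?scale1r //.
  by rewrite pnatr_eq0 -lt0n.
by rewrite -e mxrankM_maxl.
Qed.

Local Notation X := (fun k => \tr (V (nth lid class_reps k))).
Local Notation d gss := (\rank (avg (lprod gss))).

Lemma class_eq gss n1 n2 n3 n4 n5 N :
    (gss, [:: 1; n1; n2; n3; n4; n5]%N) \in test_subgroups ->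
    size (lprod gss) == N ->
  n%:R + X 1%N *+ n1 + X 2%N *+ n2 + X 3%N *+ n3 + X 4%N *+ n4 + X 5%N *+ n5
    = (N * d gss)%:R.
Proof.
move=> /class_sum e /eqP <-; rewrite -e.
rewrite !big_nat_recl // big_geq // addr0 !addrA.
by rewrite -(mxtrace1 _ n) -V1.
Qed.

Lemma trace_rep_neq k : (0 < k < 6)%N -> X k != n%:R.
Proof.
case: k => // k /andP[_ lt5]; apply/eqP=> /(V_faithful (good_reps _)).
by case: k lt5 => [|[|[|[|[|k]]]]].
Qed.

Hypothesis n7 : n = 7%N.

Lemma rank_cyc3 : d [:: cyc3 pc1] = 5%N.
Proof.
have le7 gss : (d gss <= 7)%N by rewrite -[X in (_ <= X)%N]n7 rank_leq_row.
have Ea := @class_eq [:: [:: lid; pa1]] 1 0 0 0 0 2 isT isT.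
have Eb := @class_eq [:: [:: lid; pab1]] 0 1 0 0 0 2 isT isT.
have EV := @class_eq V4a 3 0 0 0 0 4 isT isT.
have ED := @class_eq V4diag 0 3 0 0 0 4 isT isT.
have EE := @class_eq (V4a ++ V4b) 6 9 0 0 0 16 isT isT.
have EC := @class_eq [:: cyc3 pc1] 0 0 2 0 0 3 isT isT.
have ES := @class_eq [:: cyc3 pc1; [:: lid; pt1]] 3 0 2 0 0 6 isT isT.
have ECC := @class_eq [:: cyc3 pcc] 0 0 0 0 2 3 isT isT.
have ESC := @class_eq [:: cyc3 pcc; [:: lid; pt1]] 3 0 0 0 2 6 isT isT.
have E6 := @class_eq [:: cyc3 pc1; [:: lid; pb1]] 1 0 2 2 0 6 isT isT.
have E48 := @class_eq (V4a ++ cyc3 pc1 :: V4b) 6 9 8 24 0 48 isT isT.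
have E144 := @class_eq A4A4 6 9 16 48 64 144 isT isT.
have le48 : (d (V4a ++ cyc3 pc1 :: V4b)%SEQ <= d (V4a ++ V4b)%SEQ)%N.
  apply: rank_avg_sub.
  - by vm_compute.
  - by vm_compute.
  - by apply: good_sqroots; vm_compute.
  - by apply/allP; vm_compute.
have le144 : (d A4A4 <= d (V4a ++ V4b)%SEQ)%N.
  apply: rank_avg_sub.
  - by vm_compute.
  - by vm_compute.
  - by apply: good_sqroots; vm_compute.
  - by apply/allP; vm_compute.
have n7R : n%:R = 7 :> algC by rewrite n7.
apply: (degree7_arith (le7 [:: [:: lid; pa1]]) (le7 [:: [:: lid; pab1]])
  (le7 [:: cyc3 pc1]) le48 le144 (x := X 1%N) (y := X 2%N) (z := X 3%N) (w := X 4%N)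
  (r := X 5%N) (dV := d V4a) (dD := d V4diag) (dS := d [:: cyc3 pc1; [:: lid; pt1]])
  (dCC := d [:: cyc3 pcc]) (dSC := d [:: cyc3 pcc; [:: lid; pt1]])
  (d6 := d [:: cyc3 pc1; [:: lid; pb1]])).
1-3: by rewrite -n7R; apply: trace_rep_neq.
1: by rewrite -n7R -Ea ?mulr0n ?mulr1n ?addr0.
1: by rewrite -n7R -Eb ?mulr0n ?mulr1n ?addr0.
1: by rewrite -n7R -EV ?mulr0n ?mulr1n ?addr0.
1: by rewrite -n7R -ED ?mulr0n ?mulr1n ?addr0.
1: by rewrite -n7R -EE ?mulr0n ?mulr1n ?addr0.
1: by rewrite -n7R -EC ?mulr0n ?mulr1n ?addr0.
1: by rewrite -n7R -ES ?mulr0n ?mulr1n ?addr0.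
1: by rewrite -n7R -ECC ?mulr0n ?mulr1n ?addr0.
1: by rewrite -n7R -ESC ?mulr0n ?mulr1n ?addr0.
1: by rewrite -n7R -E6 ?mulr0n ?mulr1n ?addr0.
1: by rewrite -n7R -E48 ?mulr0n ?mulr1n ?addr0.
by rewrite -n7R -E144 ?mulr0n ?mulr1n ?addr0.
Qed.

(** The three subgroups have the same class counts, hence fixed spaces of the same dimension. *)
Lemma rank_three_cycle c : c \in [:: pc1; pc2; pc3] -> d [:: cyc3 c] = 5%N.
Proof.
move=> cs; rewrite -rank_cyc3.
have E1 := @class_eq [:: cyc3 pc1] 0 0 2 0 0 3 isT isT.
have E2 := @class_eq [:: cyc3 c] 0 0 2 0 0 3.
apply/eqP; rewrite -(eqn_pmul2l (isT : 0 < 3)%N) -(eqr_nat algC) -E1 E2 //.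
by move: cs; rewrite !inE => /or3P[] /eqP ->; vm_compute.
Qed.

Lemma three_cycles_fix : exists2 v : 'cV[algC]_n, v != 0 &
  {in [:: pc1; pc2; pc3], forall c, V c *m v = v}.
Proof.
have in_sub c : c \in [:: pc1; pc2; pc3] ->
    ([:: cyc3 c], [:: 1; 0; 0; 2; 0; 0]%N) \in test_subgroups.
  by rewrite !inE => /or3P[] /eqP ->; vm_compute.
(* [V] acts on columns while subspaces are row spaces, hence the transpose. *)
pose e c := (avg (lprod [:: cyc3 c]))^T.
have fix_e c (v : 'rV_n) : c \in [:: pc1; pc2; pc3] -> (v <= e c)%MS -> V c *m v^T = v^T.
  move=> cs /submxP[u ->]; have [cl good_g] := subgroup_good (in_sub c cs).
  rewrite trmx_mul trmxK mulmxA mul_avg //.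
  by move: cs; rewrite !inE => /or3P[] /eqP ->; vm_compute.
have rk c : c \in [:: pc1; pc2; pc3] -> \rank (e c) = 5%N.
  by move=> cs; rewrite mxrank_tr rank_three_cycle.
have c1s : pc1 \in [:: pc1; pc2; pc3] by [].
have c2s : pc2 \in [:: pc1; pc2; pc3] by [].
have c3s : pc3 \in [:: pc1; pc2; pc3] by [].
have : (e pc1 :&: e pc2 :&: e pc3)%MS != 0.
  have r12 := mxrank_sum_cap (e pc1) (e pc2).
  have r123 := mxrank_sum_cap (e pc1 :&: e pc2)%MS (e pc3).
  have l12 := rank_leq_row (e pc1 + e pc2)%MS.
  have l123 := rank_leq_row (e pc1 :&: e pc2 + e pc3)%MS.
  rewrite -mxrank_eq0; rewrite !rk // in r12 r123.
  rewrite [X in (_ <= X)%N]n7 in l12; rewrite [X in (_ <= X)%N]n7 in l123; lia.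
case/rowV0Pn=> v; rewrite !sub_capmx => /andP[/andP[v1 v2] v3] nz_v; exists v^T.
  by rewrite -(inj_eq (@trmx_inj _ _ _)) trmxK trmx0.
by move=> c cs; apply: fix_e => //; move: cs; rewrite !inE => /or3P[] /eqP ->.
Qed.

End Average.

(** * From lists to the symmetric group, and preliminaries on fixed vectors and cosets *)

Definition lperm (s : seq nat) : 'S_8 :=
  odflt 1%g [pick p : 'S_8 | [forall i : 'I_8, p i == nth 0%N s i :> nat]].

Lemma lpermE s (i : 'I_8) : is_lperm s -> lperm s i = nth 0%N s i :> nat.
Proof.
move=> ps; rewrite /lperm; case: pickP => [p /forallP/(_ i)/eqP // | no_p].
have sz : size s = 8%N by rewrite (perm_size ps).
have lt8 (j : 'I_8) : (nth 0%N s j < 8)%N.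
  have : nth 0%N s j \in lid by rewrite -(perm_mem ps) mem_nth ?sz.
  by rewrite (_ : lid = iota 0 8) // mem_iota.
have inj : injective (fun j : 'I_8 => Ordinal (lt8 j)).
  move=> j k /(congr1 val) /= /eqP; rewrite nth_uniq ?sz // ?(perm_uniq ps) //.
  by move/eqP/val_inj.
case/negP: (no_p (perm inj)); by apply/forallP=> j; rewrite permE.
Qed.

Lemma is_lperm_comp s t : is_lperm s -> is_lperm t -> is_lperm (lcomp s t).
Proof.
move=> ps pt; rewrite /is_lperm (perm_trans (perm_map _ ps)) //.
have sz : size t = 8%N by rewrite (perm_size pt).
suff -> : map (nth 0%N t) lid = t by [].
by rewrite (_ : lid = iota 0 8) // -sz map_nth_iota0 // take_size.
Qed.

Lemma lpermM s t : is_lperm s -> is_lperm t ->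
  lperm (lcomp s t) = (lperm s * lperm t)%g.
Proof.
move=> ps pt; apply/permP=> i; apply: val_inj.
rewrite permM /= !lpermE // ?is_lperm_comp // /lcomp.
by rewrite (nth_map 0%N) // (perm_size ps).
Qed.

Lemma lperm_inj s t : is_lperm s -> is_lperm t -> lperm s = lperm t -> s = t.
Proof.
move=> ps pt e; apply: (@eq_from_nth _ 0%N); first by rewrite (perm_size ps) (perm_size pt).
move=> i; rewrite (perm_size ps) => lti.
by rewrite -(lpermE (Ordinal lti) ps) -(lpermE (Ordinal lti) pt) e.
Qed.

Lemma lperm1 : lperm lid = 1%g.
Proof.
apply/permP=> i; apply: ord_inj; rewrite perm1 lpermE //.
by rewrite (_ : lid = iota 0 8) // nth_iota.
Qed.

(** The multiplicity is the trace of the averaging idempotent over [K], thus its rank, which is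
    positive because it fixes [v]. *)
Lemma fixed_cfdot_Res (gT : finGroupType) (G K : {group gT}) (n : nat)
    (rG : mx_representation algC G n) (v : 'cV[algC]_n) :
    K \subset G -> v != 0 -> {in K, forall k, rG k *m v = v} ->
  '['Res[K] (cfRepr rG), 1]_K > 0.
Proof.
move=> sKG nz_v fix_v; pose e := #|K|%:R^-1 *: \sum_(k in K) rG k.
have nzK : #|K|%:R != 0 :> algC by rewrite pnatr_eq0 -lt0n cardG_gt0.
have Ke k : k \in K -> rG k *m e = e.
  move=> Kk; rewrite -scalemxAr; congr (_ *: _); rewrite mulmx_sumr.
  rewrite [RHS](reindex_inj (mulgI k)) /=; apply: eq_big => [h|h Kh].
    by rewrite groupMl.
  by rewrite repr_mxM ?(subsetP sKG).
have idem_e : e *m e = e.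
  rewrite {1}/e -scalemxAl mulmx_suml (eq_bigr (fun=> e)); last by move=> k; exact: Ke.
  by rewrite sumr_const -scaler_nat scalerA mulVf // scale1r.
have ev : e *m v = v.
  rewrite /e -scalemxAl mulmx_suml (eq_bigr (fun=> v)); last by move=> k; exact: fix_v.
  by rewrite sumr_const -scaler_nat scalerA mulVf // scale1r.
have -> : '['Res[K] (cfRepr rG), 1]_K = \tr e.
  rewrite cfdotE mxtraceZ raddf_sum; congr (_ * _); apply: eq_bigr => k Kk.
  by rewrite cfResE // cfunE (subsetP sKG) // cfun1E Kk conjC1 mulr1.
rewrite mxtrace_idem // ltr0n lt0n mxrank_eq0; apply: contraNneq nz_v => e0.
by rewrite -ev e0 mul0mx.
Qed.

Lemma index2_square (gT : finGroupType) (G H : {group gT}) x :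
  H \subset G -> #|G : H| = 2 -> x \in G -> (x * x)%g \in H.
Proof.
move=> sHG iHG Gx; have nHG := index2_normal sHG iHG.
have Nx := subsetP (normal_norm nHG) x Gx.
apply: coset_idr; first exact: groupM.
rewrite morphM //=; have := expg_cardG (mem_quotient H Gx).
by rewrite card_quotient ?normal_norm // iHG expgS expg1.
Qed.

Lemma rcoset_fix_conj (gT : finGroupType) (K : {group gT}) y g :
  K :* y = K :* y :* g -> g \in K :^ y.
Proof.
move=> e; have : (y * g)%g \in K :* y :* g by rewrite mem_rcoset mulgK rcoset_refl.
by rewrite -e mem_rcoset mem_conjg conjgE invgK mulgA.
Qed.

(** * The action on the cosets of a subgroup of index 8, and its fixed vector in degree 7 *)

Section Index8.

Variables (gT : finGroupType) (G K : {group gT}).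
Hypothesis sKG : K \subset G.
Hypothesis iK : #|G : K| = 8%N.

Definition coset8 (i : 'I_8) : {set gT} := enum_val (cast_ord (esym iK) i).

Lemma coset8_mem i : coset8 i \in rcosets K G.
Proof. exact: enum_valP. Qed.

Lemma coset8_inj : injective coset8.
Proof. by move=> i j /enum_val_inj/cast_ord_inj. Qed.

Lemma coset8_surj A : A \in rcosets K G -> exists i, coset8 i = A.
Proof.
move=> SA; exists (cast_ord iK (enum_rank_in SA A)).
by rewrite /coset8 cast_ordK enum_rankK_in.
Qed.

(** Right multiplication on the numbered right cosets; the default is never taken for [g] in [G]. *)
Definition perm8 (g : gT) : 'S_8 :=
  odflt 1%g [pick p : 'S_8 | [forall i, coset8 i :* g == coset8 (p i)]].

Lemma perm8E g i : g \in G -> coset8 (perm8 g i) = coset8 i :* g.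
Proof.
move=> Gg; rewrite /perm8; case: pickP => [p /forallP/(_ i)/eqP // | no_p].
have ex j : exists k, coset8 k == coset8 j :* g.
  have /rcosetsP[x Gx ej] := coset8_mem j.
  have [k ek] : exists k, coset8 k = coset8 j :* g.
    by apply: coset8_surj; rewrite ej -rcosetM mem_rcosets mulSGid ?groupM.
  by exists k; rewrite ek.
have inj : injective (fun j => xchoose (ex j)).
  move=> j k e; have := eqP (xchooseP (ex j)); rewrite e (eqP (xchooseP (ex k))).
  by move/rcoset_inj/coset8_inj.
case/negP: (no_p (perm inj)); apply/forallP=> j.
by rewrite permE (eqP (xchooseP (ex j))).
Qed.

Lemma perm8M : {in G &, {morph perm8 : g h / (g * h)%g}}.
Proof.
move=> g h Gg Gh; apply/permP=> i; apply: coset8_inj.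
by rewrite permM !perm8E ?groupM // rcosetM.
Qed.

Canonical perm8_morphism := Morphism perm8M.

Hypothesis oG : #|G| = (2 ^ 6 * 3 ^ 2 * 5 * 7)%N.
Hypothesis nsG : forall M : {group gT}, M <| G -> M :=: 1%g \/ (#|G : M| %| 21)%N.

(** The kernel fixes the coset [K], so it lies in [K] and its index is a multiple of 8, which does
    not divide 21. *)
Lemma injm_perm8 : 'injm perm8.
Proof.
have sub : 'ker perm8 \subset K.
  have [i ei] : exists i, coset8 i = K.
    by apply: coset8_surj; rewrite -{1}(rcoset1 K) mem_rcosets mulSGid.
  apply/subsetP=> g kg; have Gg := dom_ker kg.
  have := perm8E i Gg; rewrite (mker kg) perm1 ei => ->.
  exact: rcoset_refl.
have [-> // | d21] := nsG (ker_normal perm8_morphism).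
have := indexgS G sub; rewrite iK => d8.
by have := dvdn_trans d8 d21.
Qed.

(** The image has order 20160 = 8!/2, hence index 2. *)
Lemma perm8_square p : (p * p)%g \in perm8 @* G.
Proof.
apply: (@index2_square _ [set: 'S_8]%G) => //; first exact: subsetT.
apply/eqP; rewrite -(eqn_pmul2l (cardG_gt0 (perm8 @* G))) Lagrange ?subsetT //.
by rewrite card_injm ?injm_perm8 // oG cardsT card_Sn.
Qed.

Variables (n : nat) (rG : mx_representation algC G n).
Hypothesis irr_rG : cfRepr rG \in irr G.
Hypothesis n7 : n = 7%N.

Definition good8 (s : seq nat) : Prop := is_lperm s /\ lperm s \in perm8 @* G.
Definition elt8 (s : seq nat) : gT := invm injm_perm8 (lperm s).

Lemma elt8P s : good8 s -> elt8 s \in G /\ perm8 (elt8 s) = lperm s.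
Proof.
case=> _ Is; split; last by rewrite /elt8 invmK.
by rewrite -(im_invm injm_perm8) mem_morphim.
Qed.

Lemma good8M s t : good8 s -> good8 t -> good8 (lcomp s t).
Proof.
move=> [ps Is] [pt It]; split; first exact: is_lperm_comp.
by rewrite lpermM // groupM.
Qed.

Lemma elt8M s t : good8 s -> good8 t -> elt8 (lcomp s t) = (elt8 s * elt8 t)%g.
Proof. by move=> [ps Is] [pt It]; rewrite /elt8 lpermM // morphM. Qed.

Lemma good8_sq s : is_lperm s -> good8 (lsq s).
Proof.
move=> ps; split; first exact: is_lperm_comp.
by rewrite lpermM // perm8_square.
Qed.

(** A nontrivial kernel would have index at most 21, while the index of the center of an irreducible
    character of degree 7 is at least 49. *)
Lemma cfaithful_rG s : good8 s -> \tr (rG (elt8 s)) = n%:R -> s = lid.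
Proof.
move=> gs tr_s; have [Gs es] := elt8P gs.
have ker_s : elt8 s \in cfker (cfRepr rG).
  rewrite cfkerEchar ?irr_char ?cfRepr_char //.
  by rewrite inE Gs cfRepr1 cfunE Gs tr_s /=.
have [k1 | d21] := nsG (cfker_normal (cfRepr rG)).
  apply: lperm_inj gs.1 _ _ => //; rewrite lperm1 -es.
  by move: ker_s; rewrite k1 => /set1P->; rewrite morph1.
have [i ei] := irrP irr_rG.
have := irr1_bound i; rewrite -ei => -[/=].
rewrite cfRepr1 -natrX ler_nat => le49 _.
have {le49} le49 : (7 ^ 2 <= #|G : 'Z(cfRepr rG)%CF|)%N by rewrite -n7.
have le21 := dvdn_leq (isT : 0 < 21)%N d21.
have : (#|G : 'Z(cfRepr rG)%CF| <= #|G : cfker (cfRepr rG)|)%N.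
  by rewrite dvdn_leq // indexgS // normal_sub // cfker_center_normal.
by move=> le; have := leq_trans le49 (leq_trans le le21).
Qed.

(** The elements of [lA7] fix a common vector [v] and the point 7. Through [elt8] they fill the
    stabilizer [K :^ y] of the corresponding coset, which has order 2520 as well; so [K] fixes
    [rG y *m v]. *)
Theorem index8_fixed : '['Res[K] (cfRepr rG), 1]_K > 0.
Proof.
have V1 : rG (elt8 lid) = 1%:M by rewrite /elt8 lperm1 morph1 repr_mx1.
have VM s t : good8 s -> good8 t -> rG (elt8 (lcomp s t)) = rG (elt8 s) *m rG (elt8 t).
  by move=> gs gt; rewrite elt8M // repr_mxM // (elt8P _).1.
have VU s : good8 s -> rG (elt8 s) \in unitmx.
  by move=> gs; rewrite repr_mx_unit // (elt8P gs).1.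
have [v nz_v fix_v] := three_cycles_fix good8M VM good8_sq V1 VU cfaithful_rG n7.
pose F s := good8 s /\ rG (elt8 s) *m v = v.
have g1 : good8 lid by exact: (@good8_sq lid isT).
have F1 : F lid by exact: (conj g1 (etrans (congr1 (mulmx^~ v) V1) (mul1mx v))).
have FM s t : F s -> F t -> F (lcomp s t).
  move=> [gs fs] [gt ft]; suff H : rG (elt8 (lcomp s t)) *m v = v.
    exact: (conj (good8M gs gt) H).
  by rewrite VM // -mulmxA ft.
have FA7 : {in lA7, forall s, F s}.
  apply: (@lprod_ind F); [exact: F1 | exact: FM |].
  move=> s /flattenP[_ /mapP[ws ws_in ->] /mapP[w w_in ->]].
  have lt3 : all (fun k => k < 3)%N w.
    have : all (all (all (fun k => k < 3)%N)) A7_transversals by vm_compute.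
    by move/allP/(_ _ ws_in)/allP/(_ _ w_in).
  rewrite /lword; elim: w lt3 {w_in} => [_|k w IHw /= /andP[lt3 /IHw]];
    [exact: F1 | apply: FM].
  have gs : nth lid [:: pc1; pc2; pc3] k \in [:: pc1; pc2; pc3] by rewrite mem_nth.
  suff g : good8 (nth lid [:: pc1; pc2; pc3] k) by exact: (conj g (fix_v _ gs)).
  by apply: (good_sqroots good8_sq _ gs); vm_compute.
have := lA7P; move: lA7 FA7 => W FW /and3P[/eqP sz uniqW /allP fixW].
(* This is the point 7; the numbering of the cosets being arbitrary, its coset is some [K :* y]. *)
pose o : 'I_8 := ord_max.
have /rcosetsP[y Gy eo] := coset8_mem o.
have sub_stab : {subset map elt8 W <= K :^ y}.
  move=> _ /mapP[s s_in ->]; have [gs _] := FW s s_in; have [Gs es] := elt8P gs.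
  have fo : perm8 (elt8 s) o = o.
    by apply: ord_inj; rewrite es (lpermE _ gs.1) (eqP (fixW s s_in)).
  by have := perm8E o Gs; rewrite fo eo => /rcoset_fix_conj.
have eqKy : map elt8 W =i K :^ y.
  have uniq_elt : uniq (map elt8 W).
    rewrite map_inj_in_uniq // => s t s_in t_in e.
    have [gs _] := FW s s_in; have [gt _] := FW t t_in.
    apply: lperm_inj gs.1 gt.1 _.
    by rewrite -(elt8P gs).2 -(elt8P gt).2 e.
  have sub_enum : {subset map elt8 W <= enum (K :^ y)}.
    by move=> g /sub_stab; rewrite mem_enum.
  have le : (size (enum (K :^ y)) <= size (map elt8 W))%N.
    rewrite size_map sz -cardE cardJg; have /eqP := Lagrange sKG.
    rewrite iK oG (_ : 2 ^ 6 * 3 ^ 2 * 5 * 7 = 2520 * 8)%N; last by vm_compute.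
    by rewrite eqn_pmul2r // => /eqP->.
  by have [_ eqm] := uniq_min_size uniq_elt sub_enum le; move=> g; rewrite eqm mem_enum.
apply: (@fixed_cfdot_Res _ G K n rG (rG y *m v)) => //.
  by rewrite -(mulmx0 _ (rG y)) (can_eq (mulKmx (repr_mx_unit rG Gy))).
move=> k Kk; have : (k ^ y)%g \in map elt8 W by rewrite eqKy memJ_conjg.
case/mapP=> s s_in es; have [_ fs] := FW s s_in.
have Gk := subsetP sKG k Kk.
by rewrite mulmxA -repr_mxM // conjgC repr_mxM ?groupJ // -mulmxA es fs.
Qed.

End Index8.

(** * The order of an unmarked subgroup combined with the degree 7 representation *)

Theorem theorem1p8
    (chi : seq nat -> 'CF('GL_4(2))) (psi : 'CF('GL_4(2)))
    (chi_unipotent : unipotent_chars chi)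
    (psi_irr : psi \in irr 'GL_4(2)) (psi_deg : psi 1%g = 7)
    (K : {group {'GL_4(2)}}) (K_proper : K \proper 'GL_4(2)) :
  marks [:: chi [:: 1; 1; 1; 1]%N; chi [:: 2; 1; 1]%N; chi [:: 2; 2]%N;
            chi [:: 3; 1]%N; psi] K.
Proof.
have fixed_ge0 phi : phi \in irr 'GL_4(2) -> 0 <= '['Res[K] phi, 1]_K.
  by move=> irr_phi; rewrite natr_ge0 // Cnat_cfdot_char ?rpred1 ?cfRes_char ?irr_char //;
    case/irrP: irr_phi => i ->; exact: irr_char.
set parts := [:: [:: 1; 1; 1; 1]; [:: 2; 1; 1]; [:: 2; 2]; [:: 3; 1]]%N.
have [/hasP[mu mu_in fix_mu] | /hasPn no_fix] :=
    boolP (has (fun mu => 0 < '['Res[K] (chi mu), 1]_K) parts).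
  exists (chi mu) => //; rewrite (_ : [:: _; _; _; _; _] = rcons (map chi parts) psi) //.
  by rewrite mem_rcons inE map_f ?orbT.
(* With the four unipotent multiplicities zero, [K] has index 8 and [psi] marks it. *)
exists psi; first by rewrite !inE eqxx !orbT.
have oK : #|K| = (315 * 8)%N.
  apply: (unmarked_card2520 chi_unipotent _ K_proper) => mu mu_in.
  have part_mu : is_partition 4 mu.
    by move: mu mu_in; apply/allP; vm_compute.
  have := fixed_ge0 _ (chi_unipotent.1 _ part_mu); rewrite le0r.
  by rewrite (negbTE (no_fix _ mu_in)) orbF => /eqP.
have sKG : K \subset 'GL_4(2) by exact: subsetT.
have iK : #|'GL_4(2) : K| = 8%N.
  by apply/eqP; rewrite -(eqn_pmul2l (cardG_gt0 K)) Lagrange // card_GL42 oK.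
have [i def_psi] := irrP psi_irr.
have irr_i : cfRepr 'Chi_i \in irr 'GL_4(2) by rewrite irrRepr mem_irr.
rewrite def_psi -irrRepr; apply: (index8_fixed sKG iK card_GL42 normal_GL42 irr_i).
by apply/eqP; rewrite -(eqr_nat algC) -(@cfRepr1 _ _ _ 'Chi_i) irrRepr -def_psi psi_deg.
Qed.
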